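(* Let $r,s,p,q$ be positive integers with $r\le p$, $s\le q$, and let the super minors and fake super minors $X$, $X^*$ be as defined in the context. Let $\underline i=(i_1<\dots<i_r)$, $\underline j=(j_1<\dots<j_r)$ be multi-indices from $\{1,\dots,p\}$, $\underline{\hat\mu}=(\hat\mu_1<\dots<\hat\mu_s)$, $\underline{\hat\nu}=(\hat\nu_1<\dots<\hat\nu_s)$ be multi-indices from $\{\hat1,\dots,\hat q\}$, and let $\hat\lambda\in\{\hat1,\dots,\hat q\}$, $y\in\{1,\dots,p\}$. Then the following relations hold in $\tilde{\mathcal O}$: $$X_{\underline i|\underline{\hat\mu}}\,X^*_{\underline i|\underline{\hat\mu}}=1,$$ $$(X_{\underline i|\underline{\hat\mu}})^{r+s-1}X_{\underline j|\underline{\hat\nu}}=\mathrm{Ber}\begin{pmatrix} X_{\underline i_a(j_t)|\underline{\hat\mu}} & X_{\underline i_a(\hat\nu_\beta)|\underline{\hat\mu}} \\ X^*_{\underline i|\underline{\hat\mu}_\alpha(j_t)} & X^*_{\underline i|\underline{\hat\mu}_\alpha(\hat\nu_\beta)} \end{pmatrix}_{\substack{a,t=1,\dots,r \\ \alpha,\beta=1,\dots,s}},$$ $$(X_{\underline i|\underline{\hat\mu}})^{r+s-1}X_{j_1\cdots j_{r-1}\hat\lambda|\underline{\hat\nu}}=\mathrm{Ber}\begin{pmatrix} X_{\underline i_a(j_t)|\underline{\hat\mu}} & X_{\underline i_a(\hat\lambda)|\underline{\hat\mu}} & X_{\underline i_a(\hat\nu_\beta)|\underline{\hat\mu}} \\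 X^*_{\underline i|\underline{\hat\mu}_\alpha(j_t)} & X^*_{\underline i|\underline{\hat\mu}_\alpha(\hat\lambda)} & X^*_{\underline i|\underline{\hat\mu}_\alpha(\hat\nu_\beta)} \end{pmatrix}_{\substack{a=1,\dots,r \\ t=1,\dots,r-1 \\ \alpha,\beta=1,\dots,s}},$$ $$(X^*_{\underline i|\underline{\hat\mu}})^{r+s-1}X^*_{\underline j|\hat\nu_1\cdots\hat\nu_{s-1}y}=\mathrm{Ber}^*\begin{pmatrix} X_{\underline i_a(j_t)|\underline{\hat\mu}} & X_{\underline i_a(\hat\nu_\beta)|\underline{\hat\mu}} & X_{\underline i_a(y)|\underline{\hat\mu}} \\ X^*_{\underline i|\underline{\hat\mu}_\alpha(j_t)} & X^*_{\underline i|\underline{\hat\mu}_\alpha(\hat\nu_\beta)} & X^*_{\underline i|\underline{\hat\mu}_\alpha(y)} \end{pmatrix}_{\substack{a,t=1,\dots,r \\ \alpha=1,\dots,s \\ \beta=1,\dots,s-1}}.$$ All the matrices on the right-hand sides are regarded as of size $r|s\times r|s$ (first $r$ rows, indexed by $a$, and first $r$ columns in even positions; last $s$ rows, indexed by $\alpha$, and last $s$ columns in odd positions).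
   Context: The ground field is $\mathbf k=\mathbb R$ or $\mathbb C$. A commutative superalgebra is a $\mathbb Z_2$-graded associative unital algebra with $ab=(-1)^{p(a)p(b)}ba$ for homogeneous elements. An even supermatrix $B=\begin{pmatrix} B_1 & B_2 \\ B_3 & B_4 \end{pmatrix}$ of size $r|s\times p|q$ has blocks of sizes $r\times p$, $r\times q$, $s\times p$, $s\times q$, with even entries in $B_1,B_4$ and odd entries in $B_2,B_3$; its first $p$ columns are even vectors (even entries on top, odd at the bottom) and its last $q$ columns are odd vectors (odd entries on top, even at the bottom). A fake supermatrix of type I (resp. type II) is obtained from an even supermatrix by putting an odd vector in one even column position (resp. an even vector in one odd column position). For $B$ of size $r|s\times r|s$: if $B$ is an even supermatrix or a fake supermatrix of type I with $B_4$ invertible, $\mathrm{Ber}\,B:=\det(B_4)^{-1}\det(B_1-B_2B_4^{-1}B_3)$; if $B$ is an even supermatrix or a fake supermatrix of type II with $B_1$ invertible, $\mathrm{Ber}^*B:=\det(B_1)^{-1}\det(B_4-B_3B_1^{-1}B_2)$. (In the fake cases exactly one column of the matrix whose determinant is taken has odd entries, so the determinant is unambiguous.) $\mathcal O$ is the free commutative superalgebra over $\mathbf k$ on the entries of an even supermatrix $A$ of size $r|s\times p|q$ of coordinates: even generators $x_{kj}$ and $x_{\hat m\hat l}$, odd generators $x_{k\hat l}$ and $x_{\hat mj}$ ($1\le k\le r$, $1\le m\le s$, $1\le j\le p$, $1\le l\le q$); even columns of $A$ are indexed by $1,\dots,p$ and odd columns by $\hat1,\dots,\hat q$. $\tilde{\mathcal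 O}$ is the localization of $\mathcal O$ at all $r\times r$ minors $\det(x_{ki_b})_{k,b}$ ($i_1<\dots<i_r$) of the upper left block and all $s\times s$ minors $\det(x_{\hat m\hat\jmath_b})_{m,b}$ ($\hat\jmath_1<\dots<\hat\jmath_s$) of the lower right block. For a list of $r$ indices and a list of $s$ indices separated by a bar, $A_{\cdot|\cdot}$ denotes the $r|s\times r|s$ matrix whose even column positions are filled, in the given order, by the columns of $A$ indexed by the first list and whose odd column positions are filled by the columns indexed by the second list. Set $X_{\cdot|\cdot}:=\mathrm{Ber}\,A_{\cdot|\cdot}$, where the second list consists of odd indices and the first list consists of even indices, except that one of them may be an odd index (fake super minor); and $X^*_{\cdot|\cdot}:=\mathrm{Ber}^*A_{\cdot|\cdot}$, where the first list consists of even indices and the second list consists of odd indices, except that one of them may be an even index (fake super minor). $\underline i_a(c)$ denotes the list obtained from $\underline i=(i_1,\dots,i_r)$ by replacing its $a$-th index by $c$ (without reordering), and $\underline{\hat\mu}_\alpha(c)$ the list obtained from $\underline{\hat\mu}=(\hat\mu_1,\dots,\hat\mu_s)$ by replacing its $\alpha$-th index by $c$. *)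

(* Defs.v *)
From HB Require Import structures.
From mathcomp Require Import all_boot all_order all_algebra.
From mathcomp Require Import reals.
From mathcomp Require Import complex.

Set Implicit Arguments.
Unset Strict Implicit.
Unset Printing Implicit Defensive.

Import GRing.Theory.
Local Open Scope ring_scope.

Variant ground_kind := RealGround | ComplexGround.

Definition ground_field (R : realType) (c : ground_kind) : fieldType :=
  match c with
  | RealGround => R : fieldType
  | ComplexGround => R[i] : fieldType
  end.

(* [homog false] is the even part and [homog true] the odd part; both contain 0.
   Parities add by (+) and the sign (-1)^(p(a)p(b)) is (-1) ^+ (e && f). *)
HB.mixin Record hasSuperGrading (k : fieldType) A of GRing.Algebra k A := {
  homog : bool -> A -> Prop;
  homog0 : forall e, homog e 0;
  homogD : forall e a b, homog e a -> homog e b -> homog e (a + b);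
  homogZ : forall e (c : k) a, homog e a -> homog e (c *: a);
  homog_decomp : forall a : A,
    exists a0 a1, [/\ homog false a0, homog true a1 & a = a0 + a1];
  homog_direct : forall a, homog false a -> homog true a -> a = 0;
  homog1 : homog false 1;
  homogM : forall e f a b, homog e a -> homog f b -> homog (e (+) f) (a * b);
  homogC : forall e f a b, homog e a -> homog f b ->
    a * b = (-1) ^+ (e && f) * (b * a)
}.

#[short(type="comSuperAlgType")]
HB.structure Definition ComSuperAlgebra (k : fieldType) :=
  {A of hasSuperGrading k A & GRing.Algebra k A}.

#[short(type="comSuperUnitAlgType")]
HB.structure Definition ComSuperUnitAlgebra (k : fieldType) :=
  {A of hasSuperGrading k A & GRing.UnitAlgebra k A}.

Definition parity_preserving (k : fieldType) (A B : comSuperAlgType k)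
    (f : A -> B) : Prop :=
  forall e a, homog e a -> homog e (f a).

(* Parity of a position of an r|s (or p|q) index: false on the first r
   positions, true on the last s. *)
Definition pos_parity (r s : nat) (u : 'I_(r + s)) : bool := (r <= u)%N.

Section Supermatrices.
Variables (k : fieldType) (A : comSuperAlgType k) (r s p q : nat).
Implicit Type B : 'M[A]_(r + s, p + q).

Definition even_supermatrix B : Prop :=
  forall u v, homog (pos_parity u (+) pos_parity v) (B u v).

Definition fake_supermatrix_I B : Prop :=
  exists c : 'I_p, forall u v,
    homog (pos_parity u (+) pos_parity v (+) (v == lshift q c)) (B u v).

Definition fake_supermatrix_II B : Prop :=
  exists c : 'I_q, forall u v,
    homog (pos_parity u (+) pos_parity v (+) (v == rshift p c)) (B u v).

End Supermatrices.

(* [x] is an even supermatrix whose entries freely generate O: universal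
   property of the free commutative superalgebra on these entries. *)
Definition free_on_supermatrix (k : fieldType) (r s p q : nat)
    (O : comSuperAlgType k) (x : 'M[O]_(r + s, p + q)) : Prop :=
  even_supermatrix x /\
  forall (B : comSuperAlgType k) (b : 'M[B]_(r + s, p + q)),
    even_supermatrix b ->
    exists f : {lrmorphism O -> B},
      (parity_preserving f /\ map_mx f x = b) /\
      (forall f' : {lrmorphism O -> B},
         parity_preserving f' -> map_mx f' x = b -> f' =1 f).

Definition invertible (A : pzRingType) (a : A) : Prop :=
  exists b, a * b = 1 /\ b * a = 1.

(* Universal property of the localization of O at the set [S]. *)
Definition localization_at (k : fieldType) (O L : comSuperAlgType k)
    (S : O -> Prop) (iota : {lrmorphism O -> L}) : Prop :=
  [/\ parity_preserving iota,
      forall d, S d -> invertible (iota d) &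
      forall (B : comSuperAlgType k) (f : {lrmorphism O -> B}),
        parity_preserving f -> (forall d, S d -> invertible (f d)) ->
        exists g : {lrmorphism L -> B},
          (parity_preserving g /\ (forall a, g (iota a) = f a)) /\
          (forall g' : {lrmorphism L -> B},
             parity_preserving g' -> (forall a, g' (iota a) = f a) ->
             g' =1 g)].

Definition increasing (m n : nat) (i : 'I_m -> 'I_n) : Prop :=
  forall a b : 'I_m, (a < b)%N -> (i a < i b)%N.

Definition maximal_minor (A : pzRingType) (r s p q : nat)
    (x : 'M[A]_(r + s, p + q)) (d : A) : Prop :=
  (exists2 i : 'I_r -> 'I_p, increasing i & d = \det (colsub i (ulsubmx x))) \/
  (exists2 j : 'I_s -> 'I_q, increasing j & d = \det (colsub j (drsubmx x))).

Section Berezinian.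
Variables (k : fieldType) (A : comSuperUnitAlgType k).

(* Body of [invmx], which is only available over commutative rings; used for
   matrices with even, hence commuting, entries. *)
Definition even_invmx (n : nat) (M : 'M[A]_n) : 'M[A]_n :=
  (\det M)^-1 *: \adj M.

Variables r s : nat.
Implicit Type B : 'M[A]_(r + s).

(* [\det] multiplies the entries in row order; when all columns but one have
   even entries, the order of the factors is irrelevant. *)
Definition Ber B : A :=
  (\det (drsubmx B))^-1 *
  \det (ulsubmx B - ursubmx B *m even_invmx (drsubmx B) *m dlsubmx B).

Definition Ber_star B : A :=
  (\det (ulsubmx B))^-1 *
  \det (drsubmx B - dlsubmx B *m even_invmx (ulsubmx B) *m ursubmx B).

(* [Ber] and [Ber_star] are total functions, meaningful on these domains. *)
Definition Ber_defined B : Prop :=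
  (even_supermatrix B \/ fake_supermatrix_I B) /\
  \det (drsubmx B) \is a GRing.unit.

Definition Ber_star_defined B : Prop :=
  (even_supermatrix B \/ fake_supermatrix_II B) /\
  \det (ulsubmx B) \is a GRing.unit.

End Berezinian.

(* The index of a column is a position in 'I_(p + q). *)
Definition even_cols (p q n : nat) (i : 'I_n -> 'I_p) (a : 'I_n) : 'I_(p + q) :=
  lshift q (i a).

Definition odd_cols (p q n : nat) (mu : 'I_n -> 'I_q) (a : 'I_n) : 'I_(p + q) :=
  rshift p (mu a).

Definition replace (T : Type) (n : nat) (I : 'I_n -> T) (a : 'I_n) (c : T)
    (b : 'I_n) : T :=
  if b == a then c else I b.

Definition replace_last (T : Type) (n : nat) (I : 'I_n -> T) (c : T)
    (b : 'I_n) : T :=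
  if b.+1 == n then c else I b.

Section SuperMinors.
Variables (k : fieldType) (L : comSuperUnitAlgType k) (r s p q : nat).
Variable A : 'M[L]_(r + s, p + q).

Definition select_cols (I : 'I_r -> 'I_(p + q)) (J : 'I_s -> 'I_(p + q)) :
    'M[L]_(r + s) :=
  colsub (fun u => match split u with inl a => I a | inr b => J b end) A.

Definition sminor I J : L := Ber (select_cols I J).

Definition sminor_star I J : L := Ber_star (select_cols I J).

(* Relative to the base lists i | mu, each column c of the lists J | N
   contributes the column with entries X_{i_a(c) | mu} (a = 1..r) on top and
   X^*_{i | mu_alpha(c)} (alpha = 1..s) at the bottom. *)
Definition minors_mx (i : 'I_r -> 'I_p) (mu : 'I_s -> 'I_q)
    (J : 'I_r -> 'I_(p + q)) (N : 'I_s -> 'I_(p + q)) : 'M[L]_(r + s) :=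
  let ei := even_cols q i in
  let omu := odd_cols p mu in
  block_mx
    (\matrix_(a < r, t < r) sminor (replace ei a (J t)) omu)
    (\matrix_(a < r, b < s) sminor (replace ei a (N b)) omu)
    (\matrix_(al < s, t < r) sminor_star ei (replace omu al (J t)))
    (\matrix_(al < s, b < s) sminor_star ei (replace omu al (N b))).

End SuperMinors.

(* Main.v *)
(* Let [B] be the columns [i | mu] of [A]. Super Cramer's rule says that the
   matrix of minors relative to [i | mu] is [diag (Ber B, Ber^* B) *m B^-1 *m A]
   restricted to the columns in question, so the relations express the
   multiplicativity of the Berezinian, the last one after exchanging the
   parities. Factoring [B^-1] into a lower unitriangular, a block diagonal and
   an upper unitriangular matrix, only the lower factor is not immediate; it and
   [Ber B * Ber^* B = 1] reduce to [\det (1 + V T) * \det (1 + T V) = 1] for odd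
   [V] and [T], a property of [V] (for all [T]) which is stable under sums and
   clear for multiples of matrix units. *)
From HB Require Import structures.
Require Import Defs.
From mathcomp Require Import all_boot all_order all_algebra.
From mathcomp Require Import perm boolp reals complex.

Set Implicit Arguments.
Unset Strict Implicit.
Unset Printing Implicit Defensive.

Import GRing.Theory.
Local Open Scope ring_scope.

(** * Parity components in a commutative superalgebra *)

Section Grading.
Variables (k : fieldType) (A : comSuperAlgType k).
Implicit Types (a b : A) (e f : bool).

Lemma homogN e a : homog e a -> homog e (- a).
Proof. by move=> ha; rewrite -scaleN1r; apply: homogZ. Qed.

Lemma homogB e a b : homog e a -> homog e b -> homog e (a - b).
Proof. by move=> ha hb; apply: homogD => //; apply: homogN. Qed.

Lemma homog_mul e f g a b : e (+) f = g ->
  homog e a -> homog f b -> homog g (a * b).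
Proof. by move=> <-; apply: homogM. Qed.

Lemma homog_sign n : homog false ((-1) ^+ n : A).
Proof.
rewrite -signr_odd; case: (odd n); last exact: homog1.
exact/homogN/homog1.
Qed.

Lemma homog_sum e (I : Type) (s : seq I) (P : pred I) (F : I -> A) :
  (forall i, P i -> homog e (F i)) -> homog e (\sum_(i <- s | P i) F i).
Proof.
move=> hF; apply: (big_ind (homog e)) => //; first exact: homog0.
by move=> ? ?; apply: homogD.
Qed.

Lemma homog_prod (I : Type) (s : seq I) (P : pred I) (F : I -> A) :
  (forall i, P i -> homog false (F i)) ->
  homog false (\prod_(i <- s | P i) F i).
Proof.
move=> hF; apply: (big_ind (homog false)) => //; first exact: homog1.
by move=> a b; apply: homog_mul.
Qed.

Fact even_part_ex a : exists a0, homog false a0 /\ homog true (a - a0).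
Proof.
have [a0 [a1 [h0 h1 ->]]] := homog_decomp a.
by exists a0; rewrite addrC addKr.
Qed.

(** The grading only asserts that a decomposition exists, so the component is obtained by choice;
    [even_partP] shows that the choice is immaterial. *)
Definition even_part a : A := projT1 (cid (even_part_ex a)).
Definition odd_part a : A := a - even_part a.

Lemma homog_even_part a : homog false (even_part a).
Proof. by rewrite /even_part; case: cid => ? []. Qed.

Lemma homog_odd_part a : homog true (odd_part a).
Proof. by rewrite /odd_part /even_part; case: cid => ? []. Qed.

Lemma even_partP a a0 : homog false a0 -> homog true (a - a0) ->
  even_part a = a0.
Proof.
move=> h0 h1; apply/subr0_eq/homog_direct.
  by apply: homogB => //; apply: homog_even_part.
have -> : even_part a - a0 = (a - a0) - odd_part a.
  by rewrite /odd_part opprB [RHS]addrC addrA subrK.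
by apply: homogB => //; apply: homog_odd_part.
Qed.

Lemma even_part_id a : homog false a -> even_part a = a.
Proof. by move=> h; apply: even_partP; rewrite // subrr; apply: homog0. Qed.

Lemma even_partD a b : even_part (a + b) = even_part a + even_part b.
Proof.
apply: even_partP; first by apply: homogD; apply: homog_even_part.
by rewrite opprD addrACA; apply: homogD; apply: homog_odd_part.
Qed.

Lemma odd_partD a b : odd_part (a + b) = odd_part a + odd_part b.
Proof. by rewrite /odd_part even_partD opprD addrACA. Qed.

Lemma evenC e a b : homog false a -> homog e b -> a * b = b * a.
Proof. by move=> ha hb; rewrite (homogC _ _ _ _ ha hb) mul1r. Qed.

Lemma even_central a b : homog false a -> a * b = b * a.
Proof.
move=> ha; have [b0 [b1 [h0 h1 ->]]] := homog_decomp b.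
by rewrite mulrDr mulrDl (evenC ha h0) (evenC ha h1).
Qed.

End Grading.

(* The algebra with the product of two odd elements replaced by 0. It is
   commutative, and a Leibniz sum over a matrix with at most one column that is
   not even has the same value in both algebras: this gives access to the
   determinants over commutative rings. *)
Definition square_zero (k : fieldType) (A : comSuperAlgType k) : Type := A.

(** * The commutative product that kills products of odd elements *)

Section SquareZero.
Variables (k : fieldType) (A : comSuperAlgType k).
Local Notation D := (square_zero A).

HB.instance Definition _ := GRing.Zmodule.on D.

(** With indices 0 and 1 for the parity components, this is [a0 b0 + a0 b1 + a1 b0]: only [a1 b1] is
    dropped from [a * b]. *)
Definition sqz_mul (a b : A) : A :=
  even_part a * b + odd_part a * even_part b.

Lemma sqz_mul_evenl (a b : A) : homog false a -> sqz_mul a b = a * b.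
Proof.
by move=> ha; rewrite /sqz_mul /odd_part even_part_id // subrr mul0r addr0.
Qed.

Lemma sqz_mul_evenr (a b : A) : homog false b -> sqz_mul a b = a * b.
Proof.
move=> hb; rewrite /sqz_mul (even_part_id hb) -mulrDl.
by rewrite /odd_part addrC subrK.
Qed.

Lemma even_part_sqz_mul (a b : A) :
  even_part (sqz_mul a b) = even_part a * even_part b.
Proof.
have h0 := @homog_even_part _ A; have h1 := @homog_odd_part _ A.
apply: even_partP; first exact: (homog_mul _ (h0 a) (h0 b)).
rewrite /sqz_mul addrAC -mulrBr.
apply: homogD; first exact: (homog_mul _ (h0 a) (h1 b)).
exact: (homog_mul _ (h1 a) (h0 b)).
Qed.

Fact sqz_mulC : commutative sqz_mul.
Proof.
have h0 := @homog_even_part _ A.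
have dec (a b : A) : sqz_mul a b = even_part a * even_part b +
    (even_part a * odd_part b + even_part b * odd_part a).
  rewrite /sqz_mul -(evenC (h0 b) (homog_odd_part a)) addrA -mulrDr.
  by rewrite [_ + odd_part b]addrC /odd_part subrK.
by move=> a b; rewrite !dec (evenC (h0 a) (h0 b)) [X in _ + X]addrC.
Qed.

Fact sqz_mulDl : left_distributive sqz_mul +%R.
Proof.
by move=> a b c; rewrite /sqz_mul even_partD odd_partD !mulrDl addrACA.
Qed.

Fact sqz_mulA : associative sqz_mul.
Proof.
move=> a b c; rewrite [LHS]/sqz_mul [RHS]/sqz_mul !even_part_sqz_mul.
have -> : odd_part (sqz_mul a b) =
    even_part a * odd_part b + odd_part a * even_part b.
  by rewrite /odd_part even_part_sqz_mul /sqz_mul addrAC -mulrBr.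
by rewrite /sqz_mul mulrDr [in RHS]mulrDl !mulrA addrA.
Qed.

Fact sqz_mul1l : left_id (1 : A) sqz_mul.
Proof. by move=> a; rewrite sqz_mul_evenl ?mul1r//; apply: homog1. Qed.

HB.instance Definition _ := GRing.Zmodule_isComPzRing.Build D
  sqz_mulA sqz_mulC sqz_mul1l sqz_mulDl.

(** Being the identity, it only records in which of the two rings products are taken. *)
Definition to_sqz (a : A) : D := a.

Lemma to_sqzMl a b : homog false a -> to_sqz (a * b) = to_sqz a * to_sqz b.
Proof. by move=> ha; rewrite -[RHS]/(sqz_mul a b) sqz_mul_evenl. Qed.

Lemma to_sqzMr a b : homog false b -> to_sqz (a * b) = to_sqz a * to_sqz b.
Proof. by move=> hb; rewrite -[RHS]/(sqz_mul a b) sqz_mul_evenr. Qed.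

Lemma to_sqz_sum (I : Type) (s : seq I) (P : pred I) (F : I -> A) :
  to_sqz (\sum_(i <- s | P i) F i) = \sum_(i <- s | P i) to_sqz (F i).
Proof. exact: (big_morph to_sqz). Qed.

Lemma to_sqz_sign n : to_sqz ((-1) ^+ n) = (-1) ^+ n.
Proof. by rewrite -(signr_odd D) -signr_odd; case: (odd n). Qed.

(** At most one factor is not even, so every successive multiplication has an even operand, and
    there the two products agree. *)
Lemma to_sqz_prod (I : eqType) (s : seq I) (F : I -> A) (h : pred I) :
    uniq s -> {in s &, forall i j, h i -> h j -> i = j} ->
    {in s, forall i, ~~ h i -> homog false (F i)} ->
  to_sqz (\prod_(i <- s) F i) = \prod_(i <- s) to_sqz (F i).
Proof.
elim: s => [|i s IHs] /=; first by rewrite !big_nil.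
case/andP=> i_s s_uniq hh hF; rewrite !big_cons.
rewrite -IHs //; first last.
- by move=> j js; apply: hF; rewrite inE js orbT.
- by move=> j l js ls; apply: hh; rewrite inE ?js ?ls orbT.
have [hi|hi] := boolP (h i); last by apply/to_sqzMl/hF; rewrite ?mem_head.
apply: to_sqzMr; rewrite big_seq; apply: homog_prod => j js.
apply: hF; first by rewrite inE js orbT.
apply: contra i_s => hj.
by rewrite (hh i j) ?mem_head // inE js orbT.
Qed.

End SquareZero.

(** * Determinants of matrices with at most one column that is not even *)

Section EvenDeterminants.
Variables (k : fieldType) (A : comSuperAlgType k).

Definition homog_cols n (g : pred 'I_n) m (M : 'M[A]_(m, n)) :=
  forall i j, homog (g j) (M i j).
Local Notation homog_mx e := (homog_cols (fun=> e)).

(** Columns marked by [h] are unconstrained: they may be odd or of mixed parity. *)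
Definition even_off n (h : pred 'I_n) m (M : 'M[A]_(m, n)) :=
  forall i j, ~~ h j -> homog false (M i j).

Definition at_most_one (T : Type) (h : pred T) :=
  forall i j, h i -> h j -> i = j.

Definition set_col (R : Type) m n (a : 'I_n) (w : 'cV[R]_m)
    (M : 'M[R]_(m, n)) :=
  \matrix_(i, j) if j == a then w i 0 else M i j.

Lemma homog_colsD n (g : pred 'I_n) m (M N : 'M[A]_(m, n)) :
  homog_cols g M -> homog_cols g N -> homog_cols g (M + N).
Proof. by move=> hM hN i j; rewrite mxE; apply: homogD. Qed.

Lemma homog_colsN n (g : pred 'I_n) m (M : 'M[A]_(m, n)) :
  homog_cols g M -> homog_cols g (- M).
Proof. by move=> hM i j; rewrite mxE; apply: homogN. Qed.

Lemma homog_colsB n (g : pred 'I_n) m (M N : 'M[A]_(m, n)) :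
  homog_cols g M -> homog_cols g N -> homog_cols g (M - N).
Proof. by move=> hM hN; apply/homog_colsD/homog_colsN. Qed.

Lemma homog_scalar_mx n (a : A) :
  homog false a -> homog_mx false (a%:M : 'M[A]_n).
Proof. by move=> ha i j; rewrite mxE; case: eqP => // _; apply: homog0. Qed.

Lemma homog_mx1 n : homog_mx false (1%:M : 'M[A]_n).
Proof. exact/homog_scalar_mx/homog1. Qed.

Lemma homog_cols_mul e n (f g : pred 'I_n) m p (M : 'M[A]_(p, m))
    (N : 'M[A]_(m, n)) : (forall j, e (+) f j = g j) ->
  homog_mx e M -> homog_cols f N -> homog_cols g (M *m N).
Proof.
move=> efg hM hN i j; rewrite mxE -efg; apply: homog_sum => l _.
exact: homog_mul (hM _ _) (hN _ _).
Qed.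

Lemma even_off_even n (h : pred 'I_n) m (M : 'M[A]_(m, n)) :
  homog_mx false M -> even_off h M.
Proof. by move=> hM i j _. Qed.

Lemma even_off_cols n (g : pred 'I_n) m (M : 'M[A]_(m, n)) :
  homog_cols g M -> even_off g M.
Proof. by move=> hM i j /negPf gj; have := hM i j; rewrite gj. Qed.

Lemma even_off_mul n (h : pred 'I_n) m p (M : 'M[A]_(p, m)) (N : 'M_(m, n)) :
  homog_mx false M -> even_off h N -> even_off h (M *m N).
Proof.
move=> hM hN i j hj; rewrite mxE; apply: homog_sum => l _.
exact: homog_mul (hM _ _) (hN _ _ hj).
Qed.

Lemma homog_det n (M : 'M[A]_n) : homog_mx false M -> homog false (\det M).
Proof.
move=> hM; apply: homog_sum => s _; apply: homog_mul (homog_sign _ _) _ => //.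
exact: homog_prod.
Qed.

Lemma homog_adj n (M : 'M[A]_n) : homog_mx false M -> homog_mx false (\adj M).
Proof.
move=> hM i j; rewrite mxE; apply: homog_mul (homog_sign _ _) _ => //.
by apply: homog_det => u v; rewrite !mxE.
Qed.

Lemma to_sqz_det n (h : pred 'I_n) (M : 'M[A]_n) :
    at_most_one h -> even_off h M ->
  to_sqz (\det M) = \det (map_mx (@to_sqz _ A) M).
Proof.
move=> h1 hM; rewrite to_sqz_sum; apply: eq_bigr => s _.
rewrite to_sqzMl; last exact: homog_sign.
rewrite to_sqz_sign; congr (_ * _).
(* In the term of [s], the factor of row [i] comes from column [s i], so the exceptional row is the
   preimage of the exceptional column. *)
rewrite (to_sqz_prod (h := fun i => h (s i))) ?index_enum_uniq//.
- by apply: eq_bigr => i _; rewrite mxE.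
- by move=> i j _ _ hi hj; apply/(@perm_inj _ s)/h1.
- by move=> i _; apply: hM.
Qed.

Lemma to_sqz_det_even n (M : 'M[A]_n) : homog_mx false M ->
  to_sqz (\det M) = \det (map_mx (@to_sqz _ A) M).
Proof.
by move=> hM; apply: (@to_sqz_det _ pred0) => //; apply: even_off_even.
Qed.

Lemma to_sqz_mulmx m n p (M : 'M[A]_(m, n)) (N : 'M[A]_(n, p)) :
    homog_mx false M ->
  map_mx (@to_sqz _ A) (M *m N) =
  map_mx (@to_sqz _ A) M *m map_mx (@to_sqz _ A) N.
Proof.
move=> hM; apply/matrixP => i j; rewrite !mxE to_sqz_sum.
by apply: eq_bigr => l _; rewrite !mxE to_sqzMl.
Qed.

Lemma to_sqz_adj n (M : 'M[A]_n) : homog_mx false M ->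
  map_mx (@to_sqz _ A) (\adj M) = \adj (map_mx (@to_sqz _ A) M).
Proof.
move=> hM; apply/matrixP => i j; rewrite !mxE to_sqzMl; last exact: homog_sign.
rewrite to_sqz_sign to_sqz_det_even; last by move=> u v; rewrite !mxE.
by rewrite map_row' map_col'.
Qed.

Lemma to_sqz_inj m n : injective (@map_mx _ _ (@to_sqz _ A) m n).
Proof.
by move=> M N /matrixP MN; apply/matrixP => i j; have := MN i j; rewrite !mxE.
Qed.

Lemma map_to_sqz_scalar n (a : A) :
  map_mx (@to_sqz _ A) (a%:M : 'M_n) = (to_sqz a)%:M.
Proof. by apply/matrixP => i j; rewrite !mxE; case: eqP. Qed.

Lemma det_mulmx_even n (h : pred 'I_n) (M N : 'M[A]_n) :
    at_most_one h -> homog_mx false M -> even_off h N ->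
  \det (M *m N) = \det M * \det N.
Proof.
(* Since [to_sqz] is convertible to the identity, an equation in [A] may be proved in the
   commutative ring. *)
move=> h1 hM hN; apply: (id : to_sqz _ = to_sqz _ -> _).
rewrite to_sqzMl ?(to_sqz_det_even hM) ?(to_sqz_det h1 hN); last first.
  exact: homog_det.
rewrite (to_sqz_det h1); last exact: even_off_mul.
by rewrite to_sqz_mulmx // det_mulmx.
Qed.

Lemma det_tr_even n (M : 'M[A]_n) : homog_mx false M -> \det M^T = \det M.
Proof.
move=> hM; apply: (id : to_sqz _ = to_sqz _ -> _).
rewrite !to_sqz_det_even //; last by move=> i j; rewrite mxE.
by rewrite -[in RHS]det_tr map_trmx.
Qed.

Lemma det_scalar_even n (a : A) :
  homog false a -> \det (a%:M : 'M[A]_n) = a ^+ n.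
Proof.
move=> ha; apply: (id : to_sqz _ = to_sqz _ -> _).
rewrite to_sqz_det_even; last exact: homog_scalar_mx.
rewrite map_to_sqz_scalar det_scalar; elim: n => [//|n IHn].
by rewrite exprS IHn -to_sqzMl // -exprS.
Qed.

Lemma mul_mx_adj_even n (M : 'M[A]_n) : homog_mx false M ->
  M *m \adj M = (\det M)%:M.
Proof.
move=> hM; apply: to_sqz_inj; rewrite to_sqz_mulmx // to_sqz_adj //.
by rewrite mul_mx_adj map_to_sqz_scalar to_sqz_det_even.
Qed.

Lemma mul_adj_mx_even n (M : 'M[A]_n) : homog_mx false M ->
  \adj M *m M = (\det M)%:M.
Proof.
move=> hM; apply: to_sqz_inj; rewrite to_sqz_mulmx; last exact: homog_adj.
by rewrite to_sqz_adj // mul_adj_mx map_to_sqz_scalar to_sqz_det_even.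
Qed.

Lemma scalemxAr_even m n p (a : A) (M : 'M[A]_(m, n)) (N : 'M_(n, p)) :
  homog false a -> M *m (a *: N) = a *: (M *m N).
Proof.
move=> ha; apply/matrixP => i j; rewrite !mxE mulr_sumr.
by apply: eq_bigr => l _; rewrite !mxE !mulrA (even_central _ ha).
Qed.

(** The cofactors along column [a] do not see [w]; they are those of the identity matrix, read off
    from [adj1]. *)
Lemma det_set_col1_com (R : comPzRingType) n (a : 'I_n) (w : 'cV[R]_n) :
  \det (set_col a w 1%:M) = w a 0.
Proof.
rewrite (expand_det_col _ a) (bigD1 a) //= big1 ?addr0 => [|i ia].
  have /matrixP /(_ a a) := @adj1 R n; rewrite !mxE !eqxx => e1.
  rewrite -[RHS]mulr1 -[1 in RHS]e1 /cofactor; congr (_ * (_ * \det _)).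
  by apply/matrixP => u v; rewrite !mxE eq_sym (negPf (neq_lift _ _)).
have /matrixP /(_ a i) := @adj1 R n; rewrite !mxE eqxx eq_sym (negPf ia) => e0.
suff -> : cofactor (set_col a w 1%:M) i a = 0 by rewrite mulr0.
apply: etrans e0; rewrite /cofactor; congr (_ * \det _).
by apply/matrixP => u v; rewrite !mxE eq_sym (negPf (neq_lift _ _)).
Qed.

Lemma det_set_col1 n (a : 'I_n) (w : 'cV[A]_n) :
  \det (set_col a w 1%:M) = w a 0.
Proof.
apply: (id : to_sqz _ = to_sqz _ -> _).
rewrite (@to_sqz_det _ (pred1 a)); first last.
- by move=> i j /= /negPf ja; rewrite mxE ja; apply: homog_mx1.
- by move=> i j /= /eqP-> /eqP->.
transitivity (\det (set_col a (map_mx (@to_sqz _ A) w) 1%:M)).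
  by congr (\det _); apply/matrixP => i j; rewrite !mxE; do 2?case: eqP.
by rewrite det_set_col1_com mxE.
Qed.

Lemma mulmx_set_col m n p (a : 'I_p) (M : 'M[A]_(m, n)) (w : 'cV_n)
    (N : 'M_(n, p)) :
  M *m set_col a w N = set_col a (M *m w) (M *m N).
Proof.
apply/matrixP => i j; rewrite !mxE; case: ifP => ja;
by rewrite ?mxE; apply: eq_bigr => l _; rewrite !mxE ja.
Qed.

End EvenDeterminants.

(** * Inverses of even matrices and Cramer's rule *)

Section EvenInverse.
Variables (k : fieldType) (A : comSuperUnitAlgType k).
Local Notation homog_mx e := (homog_cols (fun=> e)).

(** If [b1] is the odd component of the inverse, then [a * b1] is odd and also equals an even
    element, so it vanishes; [a] being a unit, [b1 = 0]. *)
Lemma homogV (a : A) : a \is a GRing.unit -> homog false a -> homog false a^-1.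
Proof.
move=> ua ha; have [b0 [b1 [h0 h1 eb]]] := homog_decomp (a^-1).
have /eqP : a * b0 - 1 = - (a * b1).
  apply/eqP; rewrite subr_eq addrC -subr_eq opprK -mulrDr -eb mulrV //.
rewrite -addr_eq0 => /eqP E.
have ab1 : a * b1 = 0.
  apply: homog_direct; last exact: homog_mul ha h1.
  rewrite -(addKr (a * b0 - 1) (a * b1)) E addr0.
  by apply/homogN/homogB; [apply: homog_mul ha h0 | apply: homog1].
by rewrite eb -[b1](mulKr ua) ab1 mulr0 addr0.
Qed.

Section Fixed.
Variables (n : nat) (M : 'M[A]_n).
Hypotheses (hM : homog_mx false M) (uM : \det M \is a GRing.unit).

Lemma homog_invmx : homog_mx false (even_invmx M).
Proof.
move=> i j; rewrite mxE.
by apply: homog_mul (homogV uM (homog_det hM)) (homog_adj hM _ _).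
Qed.

Lemma mulVmx_even : even_invmx M *m M = 1%:M.
Proof.
rewrite -scalemxAl mul_adj_mx_even // scale_scalar_mx mulVr //.
Qed.

Lemma mulmxV_even : M *m even_invmx M = 1%:M.
Proof.
rewrite scalemxAr_even; last exact: homogV uM (homog_det hM).
by rewrite mul_mx_adj_even // scale_scalar_mx mulVr //.
Qed.

Lemma mulKmx_even p (N : 'M_(n, p)) : even_invmx M *m (M *m N) = N.
Proof. by rewrite mulmxA mulVmx_even mul1mx. Qed.

Lemma mulKVmx_even p (N : 'M_(n, p)) : M *m (even_invmx M *m N) = N.
Proof. by rewrite mulmxA mulmxV_even mul1mx. Qed.

Lemma mulmxK_even p (N : 'M_(p, n)) : N *m M *m even_invmx M = N.
Proof. by rewrite -mulmxA mulmxV_even mulmx1. Qed.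

Lemma mulmxKV_even p (N : 'M_(p, n)) : N *m even_invmx M *m M = N.
Proof. by rewrite -mulmxA mulVmx_even mulmx1. Qed.

Lemma det1_even : \det (1%:M : 'M[A]_n) = 1.
Proof.
apply: (id : to_sqz _ = to_sqz _ -> _).
by rewrite to_sqz_det_even ?map_to_sqz_scalar ?det1 //; apply: homog_mx1.
Qed.

Lemma det_invmx_even : \det (even_invmx M) = (\det M)^-1.
Proof.
apply: (mulrI uM).
rewrite -(@det_mulmx_even _ _ _ pred0) ?mulmxV_even ?mulrV ?det1_even //.
exact/even_off_even/homog_invmx.
Qed.

(** Factoring out [M] leaves the identity with one column replaced by [even_invmx M *m w].
    Multiplicativity tolerates one arbitrary column in the right factor, so [w] may have any
    parity. *)
Lemma cramer_even a (w : 'cV_n) :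
  \det (set_col a w M) = \det M * (even_invmx M *m w) a 0.
Proof.
have -> : set_col a w M = M *m set_col a (even_invmx M *m w) 1%:M.
  by rewrite mulmx_set_col mulKVmx_even mulmx1.
rewrite (@det_mulmx_even _ _ _ (pred1 a)) ?det_set_col1//.
- by move=> i j /= /eqP-> /eqP->.
- by move=> i j /= /negPf ja; rewrite mxE ja; apply: homog_mx1.
Qed.

End Fixed.

Lemma invmx_eq n (M N : 'M[A]_n) : homog_mx false M ->
  \det M \is a GRing.unit -> M *m N = 1%:M -> even_invmx M = N.
Proof. by move=> hM uM e; rewrite -[N](mulKmx_even hM uM) e mulmx1. Qed.

Lemma unit_det_mul n (M N : 'M[A]_n) : homog_mx false M -> homog_mx false N ->
  (\det (M *m N) \is a GRing.unit) =
  (\det M \is a GRing.unit) && (\det N \is a GRing.unit).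
Proof.
move=> hM hN; rewrite (@det_mulmx_even _ _ _ pred0) //.
by rewrite unitrM_comm //; apply/even_central/homog_det.
Qed.

Lemma invmxM_even n (M N : 'M[A]_n) : homog_mx false M -> homog_mx false N ->
    \det M \is a GRing.unit -> \det N \is a GRing.unit ->
  even_invmx (M *m N) = even_invmx N *m even_invmx M.
Proof.
move=> hM hN uM uN; apply: invmx_eq; first exact: homog_cols_mul hM hN.
  by rewrite unit_det_mul // uM.
by rewrite -mulmxA mulKVmx_even // mulmxV_even.
Qed.

(** * The determinant identity for a pair of odd matrices *)

Section OddPair.
Hypothesis two_neq0 : (2%:R : k) != 0.

Lemma odd_sqr (v : A) : homog true v -> v * v = 0.
Proof.
move=> hv; have := homogC _ _ _ _ hv hv; rewrite mulN1r => /eqP.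
rewrite -addr_eq0 -mulr2n -scaler_nat scaler_eq0 (negPf two_neq0).
by move=> /eqP.
Qed.

(** Quantifying over all [T] is what makes the property additive in [V]: the proof for a sum applies
    it to a modified [T]. *)
Definition odd_pair_inverse r s (V : 'M[A]_(s, r)) := homog_mx true V /\
  forall T : 'M[A]_(r, s), homog_mx true T ->
    \det (1%:M + V *m T) * \det (1%:M + T *m V) = 1.

Lemma homog_mx1D r s (V : 'M[A]_(s, r)) (T : 'M[A]_(r, s)) :
  homog_mx true V -> homog_mx true T -> homog_mx false (1%:M + V *m T).
Proof.
move=> hV hT; apply: homog_colsD; first exact: homog_mx1.
exact: homog_cols_mul hV hT.
Qed.

Lemma odd_pair_inverse0 r s : odd_pair_inverse (0 : 'M[A]_(s, r)).
Proof.
split=> [i j|T hT]; first by rewrite mxE; apply: homog0.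
by rewrite mul0mx mulmx0 !addr0 !det1_even mulr1.
Qed.

(** With [T' = T P^-1 = Q^-1 T], the two matrices factor as [(1 + W T') P] and [Q (1 + T' W)]. The
    inner factors cancel by the property of [V] at [T], the outer ones by that of [W] at [T']. *)
Lemma odd_pair_inverseD r s (V W : 'M[A]_(s, r)) :
  odd_pair_inverse V -> odd_pair_inverse W -> odd_pair_inverse (V + W).
Proof.
move=> [hV IV] [hW IW]; split=> [|T hT]; first exact: homog_colsD.
set P := 1%:M + V *m T; set Q := 1%:M + T *m V.
have hP : homog_mx false P by apply: homog_mx1D.
have hQ : homog_mx false Q by apply: homog_mx1D.
have PQ : \det P * \det Q = 1 by apply: IV.
have QP : \det Q * \det P = 1 by rewrite -(even_central _ (homog_det hP)).
have uP : \det P \is a GRing.unit by apply/unitrP; exists (\det Q).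
have uQ : \det Q \is a GRing.unit by apply/unitrP; exists (\det P).
pose T' := T *m even_invmx P.
have hT' : homog_mx true T' by apply: homog_cols_mul hT (homog_invmx hP uP).
(* Push-through identity: [(1 + T V) T = T (1 + V T)]. *)
have TT' : Q *m T' = T.
  rewrite /T' mulmxA; have -> : Q *m T = T *m P.
    by rewrite mulmxDl mulmxDr mul1mx mulmx1 !mulmxA.
  by rewrite mulmxK_even.
have -> : 1%:M + (V + W) *m T = (1%:M + W *m T') *m P.
  by rewrite mulmxDl mul1mx -mulmxA mulmxKV_even // mulmxDl addrA.
have -> : 1%:M + T *m (V + W) = Q *m (1%:M + T' *m W).
  by rewrite mulmxDr mulmx1 mulmxA TT' mulmxDr addrA.
have hWT : homog_mx false (1%:M + W *m T') by apply: homog_mx1D.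
rewrite !(@det_mulmx_even _ _ _ pred0) //.
  by rewrite mulrA -[X in X * _]mulrA PQ mulr1; apply: IW.
by apply: even_off_even; apply: homog_mx1D.
Qed.

(** With [t = T a al], the product is [(1 + v t)(1 + t v) = (1 + v t)(1 - v t) = 1 - v t v t], and
    [v t v = - v v t = 0]. *)
Lemma odd_pair_inverse_delta r s (v : A) (al : 'I_s) (a : 'I_r) :
  homog true v -> odd_pair_inverse (v *: delta_mx al a).
Proof.
move=> hv.
have hV : homog_mx true (v *: delta_mx al a).
  move=> i j; rewrite !mxE.
  by case: (_ && _); rewrite ?mulr1 // mulr0; apply: homog0.
split=> // T hT.
have -> : 1%:M + T *m (v *: delta_mx al a) =
    set_col a (\col_i ((i == a)%:R + T i al * v)) 1%:M.
  apply/matrixP => i j; rewrite !mxE (bigD1 al) //= big1 => [|l /negPf nl].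
    rewrite !mxE eqxx /= addr0; case: (eqVneq j a) => [->|ja].
      by rewrite mulr1.
    by rewrite !mulr0 addr0.
  by rewrite !mxE nl !mulr0.
(* Here [V T] is supported on row [al]; transposing turns this row into a column, as [det_set_col1]
   requires. *)
rewrite -det_tr_even; last exact: homog_mx1D.
have -> : (1%:M + v *: delta_mx al a *m T)^T =
    set_col al (\col_i ((i == al)%:R + v * T a i)) 1%:M.
  apply/matrixP => i j; rewrite !mxE (bigD1 a) //= big1 => [|l /negPf nl].
    rewrite !mxE eqxx andbT addr0; case: (eqVneq j al) => [->|ja].
      by rewrite mulr1 eq_sym.
    by rewrite mulr0 mul0r addr0 eq_sym.
  by rewrite !mxE nl andbF mulr0 mul0r.
rewrite !det_set_col1 !mxE !eqxx (homogC _ _ _ _ (hT a al) hv) mulN1r.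
rewrite mulrBr mulr1 mulrDl mul1r opprD addrA addrK mulrA -[v * _ * v]mulrA.
rewrite (homogC _ _ _ _ (hT a al) hv) mulN1r mulrN mulrA odd_sqr //.
by rewrite mul0r oppr0 mul0r subr0.
Qed.

(* An odd matrix is a sum of odd multiples of matrix units, for which the two
   determinants are [1 + v t] and [1 + t v = 1 - v t] with [v ^+ 2 = 0]. *)
Lemma det_odd_pair r s (V : 'M[A]_(s, r)) (T : 'M[A]_(r, s)) :
    homog_mx true V -> homog_mx true T ->
  \det (1%:M + V *m T) * \det (1%:M + T *m V) = 1.
Proof.
move=> hV; suff [_] : odd_pair_inverse V by apply.
rewrite [V]matrix_sum_delta; apply: big_ind => [||al _].
- exact: odd_pair_inverse0.
- exact: odd_pair_inverseD.
apply: big_ind => [||a _].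
- exact: odd_pair_inverse0.
- exact: odd_pair_inverseD.
exact: odd_pair_inverse_delta.
Qed.

Lemma unit_det_odd_pair r s (V : 'M[A]_(s, r)) (T : 'M[A]_(r, s)) :
    homog_mx true V -> homog_mx true T ->
  \det (1%:M + V *m T) \is a GRing.unit.
Proof.
move=> hV hT; apply/unitrP; exists (\det (1%:M + T *m V)).
by rewrite !det_odd_pair.
Qed.

End OddPair.
End EvenInverse.

(** * Berezinians under left multiplication by block factors *)

Section Berezinians.
Variables (k : fieldType) (A : comSuperUnitAlgType k).
Hypothesis two_neq0 : (2%:R : k) != 0.
Local Notation homog_mx e := (homog_cols (fun=> e)).

(** The predicate [g] marks the even positions holding an odd vector: [pred0] gives even
    supermatrices, one marked position gives type I fakes, so both cases are treated at once. *)
Definition super_blocks r s (g : pred 'I_r) (N1 : 'M[A]_r) (N2 : 'M[A]_(r, s))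
    (N3 : 'M[A]_(s, r)) (N4 : 'M[A]_s) : Prop :=
  [/\ homog_cols g N1, homog_mx true N2, homog_cols (predC g) N3,
      homog_mx false N4 & \det N4 \is a GRing.unit].

Definition schur r s (B1 : 'M[A]_r) (B2 : 'M[A]_(r, s)) (B3 : 'M[A]_(s, r))
    (B4 : 'M[A]_s) : 'M[A]_r :=
  B1 - B2 *m even_invmx B4 *m B3.

(* The top part of the solution [w] of [B *m w = v], for the matrix [B] with
   blocks [B1 B2 B3 B4] and [v] with blocks [v1 v3]. *)
Definition top_solution r s (B1 : 'M[A]_r) (B2 : 'M[A]_(r, s))
    (B3 : 'M[A]_(s, r)) (B4 : 'M[A]_s) n (v1 : 'M[A]_(r, n)) (v3 : 'M[A]_(s, n)) : 'M[A]_(r, n) :=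
  even_invmx (schur B1 B2 B3 B4) *m (v1 - B2 *m even_invmx B4 *m v3).

Lemma Ber_block r s (B1 : 'M[A]_r) (B2 : 'M[A]_(r, s)) (B3 : 'M[A]_(s, r)) B4 :
  Ber (block_mx B1 B2 B3 B4) = (\det B4)^-1 * \det (schur B1 B2 B3 B4).
Proof. by rewrite /Ber block_mxKul block_mxKur block_mxKdl block_mxKdr. Qed.

(** Exchanging the parities reduces all statements about [Ber_star] to statements about [Ber]. *)
Lemma Ber_star_block r s (B1 : 'M[A]_r) (B2 : 'M[A]_(r, s))
    (B3 : 'M[A]_(s, r)) B4 :
  Ber_star (block_mx B1 B2 B3 B4) = Ber (block_mx B4 B3 B2 B1).
Proof.
by rewrite Ber_block /Ber_star block_mxKul block_mxKur block_mxKdl block_mxKdr.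
Qed.

Lemma homog_schur r s (g : pred 'I_r) (N1 : 'M[A]_r) (N2 : 'M[A]_(r, s))
    (N3 : 'M[A]_(s, r)) (N4 : 'M[A]_s) :
  super_blocks g N1 N2 N3 N4 -> homog_cols g (schur N1 N2 N3 N4).
Proof.
move=> [h1 h2 h3 h4 u4]; apply: homog_colsB => //.
apply: (homog_cols_mul (e := true) (f := predC g)) => // [j|].
  exact: negbK.
by apply: homog_cols_mul h2 (homog_invmx h4 u4).
Qed.

Section SuperBlocks.
Variables (r s : nat) (g : pred 'I_r).
Hypothesis g1 : at_most_one g.
Variables (N1 : 'M[A]_r) (N2 : 'M[A]_(r, s)) (N3 : 'M[A]_(s, r)) (N4 : 'M[A]_s).
Hypothesis hN : super_blocks g N1 N2 N3 N4.

(** The lower right block is multiplied by [P] and the Schur complement by the inverse of [Q]; the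
    two effects cancel because [\det P * \det Q = 1]. *)
Lemma super_blocks_lower (V : 'M[A]_(s, r)) : homog_mx true V ->
  super_blocks g N1 N2 (N3 + V *m N1) (N4 + V *m N2) /\
  Ber (block_mx N1 N2 (N3 + V *m N1) (N4 + V *m N2)) =
  Ber (block_mx N1 N2 N3 N4).
Proof.
move=> hV; have [h1 h2 h3 h4 u4] := hN.
pose T := N2 *m even_invmx N4.
have hT : homog_mx true T by apply: homog_cols_mul h2 (homog_invmx h4 u4).
pose P := 1%:M + V *m T; pose Q := 1%:M + T *m V.
have hP : homog_mx false P by apply: homog_mx1D.
have hQ : homog_mx false Q by apply: homog_mx1D.
have uP : \det P \is a GRing.unit by apply: unit_det_odd_pair.
have e4 : N4 + V *m N2 = P *m N4.
  by rewrite mulmxDl mul1mx /T !mulmxA mulmxKV_even.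
have u4' : \det (N4 + V *m N2) \is a GRing.unit.
  by rewrite e4 unit_det_mul // uP.
have hN' : super_blocks g N1 N2 (N3 + V *m N1) (N4 + V *m N2).
  split=> //; first by apply: homog_colsD => //; apply: homog_cols_mul hV h1.
  by apply: homog_colsD => //; apply: homog_cols_mul hV h2.
split=> //; rewrite !Ber_block.
(* By [Q T = T P], the inverse of [P] disappears from the correction term; then the two terms
   [T V N1] cancel. *)
have -> : schur N1 N2 N3 N4 = Q *m schur N1 N2 (N3 + V *m N1) (N4 + V *m N2).
  rewrite /schur e4 invmxM_even // mulmxBr !mulmxA -[Q *m N2 *m _]mulmxA -/T.
  have -> : Q *m T = T *m P.
    by rewrite mulmxDl mulmxDr mul1mx mulmx1 !mulmxA.
  rewrite mulmxK_even // mulmxDr mulmxDl mul1mx !mulmxA.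
  by rewrite [T *m N3 + _]addrC opprD addrA addrK.
have PQ : \det P * \det Q = 1 by apply: det_odd_pair.
rewrite (det_mulmx_even g1) //; last exact/even_off_cols/(homog_schur hN').
rewrite e4 (@det_mulmx_even _ _ _ pred0) // invrM // -mulrA.
by rewrite -[(\det P)^-1]mulr1 -PQ mulKr.
Qed.

(** In the Schur complement [Q] cancels against its inverse and [P] factors out on the left. *)
Lemma super_blocks_diag (P : 'M[A]_r) (Q : 'M[A]_s) :
    homog_mx false P -> homog_mx false Q -> \det Q \is a GRing.unit ->
  super_blocks g (P *m N1) (P *m N2) (Q *m N3) (Q *m N4) /\
  Ber (block_mx (P *m N1) (P *m N2) (Q *m N3) (Q *m N4)) =
  \det P * (\det Q)^-1 * Ber (block_mx N1 N2 N3 N4).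
Proof.
move=> hP hQ uQ; have [h1 h2 h3 h4 u4] := hN; split.
  split; rewrite ?unit_det_mul ?uQ //.
  - exact: homog_cols_mul hP h1.
  - exact: homog_cols_mul hP h2.
  - exact: homog_cols_mul hQ h3.
  - exact: homog_cols_mul hQ h4.
rewrite !Ber_block.
have -> : schur (P *m N1) (P *m N2) (Q *m N3) (Q *m N4) =
    P *m schur N1 N2 N3 N4.
  by rewrite /schur invmxM_even // mulmxBr !mulmxA mulmxKV_even.
rewrite (det_mulmx_even g1) //; last exact/even_off_cols/(homog_schur hN).
rewrite (@det_mulmx_even _ _ _ pred0) // invrM // !mulrA.
have hVQ := homogV uQ (homog_det hQ).
rewrite -[_ * \det P](even_central _ (homog_det hP)).
by rewrite -[_ / \det Q in LHS](even_central _ hVQ) !mulrA.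
Qed.

(** Neither [N4] nor the Schur complement changes: the terms [U N3] cancel. *)
Lemma super_blocks_upper (U : 'M[A]_(r, s)) : homog_mx true U ->
  super_blocks g (N1 + U *m N3) (N2 + U *m N4) N3 N4 /\
  Ber (block_mx (N1 + U *m N3) (N2 + U *m N4) N3 N4) =
  Ber (block_mx N1 N2 N3 N4).
Proof.
move=> hU; have [h1 h2 h3 h4 u4] := hN; split.
  split=> //; apply: homog_colsD => //.
    by apply: homog_cols_mul hU h3 => j; apply: negbK.
  exact: homog_cols_mul hU h4.
rewrite !Ber_block; congr (_ * \det _).
by rewrite /schur !mulmxDl mulmxK_even // opprD addrA addrAC addrK.
Qed.

End SuperBlocks.

(** * Even supermatrices with both diagonal blocks invertible *)

Section Inverse.
Variables (r s : nat).
Variables (B1 : 'M[A]_r) (B2 : 'M[A]_(r, s)) (B3 : 'M[A]_(s, r)) (B4 : 'M[A]_s).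
Hypotheses (h1 : homog_mx false B1) (h2 : homog_mx true B2).
Hypotheses (h3 : homog_mx true B3) (h4 : homog_mx false B4).
Hypotheses (u1 : \det B1 \is a GRing.unit) (u4 : \det B4 \is a GRing.unit).

Let hB : super_blocks pred0 B1 B2 B3 B4. Proof. by split. Qed.

Let P : 'M[A]_(r, s) := even_invmx B1 *m B2.
Let Q : 'M[A]_(s, r) := - (even_invmx B4 *m B3).

Let hP : homog_mx true P.
Proof. by apply: homog_cols_mul (homog_invmx h1 u1) h2. Qed.

Let hQ : homog_mx true Q.
Proof.
by apply: homog_colsN; apply: homog_cols_mul (homog_invmx h4 u4) h3.
Qed.

Lemma schurE : schur B1 B2 B3 B4 = B1 *m (1%:M + P *m Q).
Proof.
by rewrite mulmxDr mulmx1 mulmxN mulmxN !mulmxA mulmxV_even // mul1mx.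
Qed.

(** By [schurE] the determinant is that of [B1] times one of the form [\det (1 + P Q)] with [P] and
    [Q] odd, a unit by the odd pair identity. *)
Lemma schur_unit : \det (schur B1 B2 B3 B4) \is a GRing.unit.
Proof.
rewrite schurE unit_det_mul ?u1 //; last exact: homog_mx1D.
exact: unit_det_odd_pair.
Qed.

Lemma homog_Ber : homog false (Ber (block_mx B1 B2 B3 B4)).
Proof.
rewrite Ber_block.
apply: homog_mul (homogV u4 (homog_det h4)) (homog_det _) => //.
exact: homog_schur (hB).
Qed.

End Inverse.

Section Solution.
Variables (r s : nat).
Variables (B1 : 'M[A]_r) (B2 : 'M[A]_(r, s)) (B3 : 'M[A]_(s, r)) (B4 : 'M[A]_s).
Hypotheses (h1 : homog_mx false B1) (h2 : homog_mx true B2).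
Hypotheses (h3 : homog_mx true B3) (h4 : homog_mx false B4).
Hypotheses (u1 : \det B1 \is a GRing.unit) (u4 : \det B4 \is a GRing.unit).

Let D1 := schur B1 B2 B3 B4.
Let D4 := schur B4 B3 B2 B1.
Let hD1 : homog_mx false D1.
Proof. by apply: (@homog_schur _ _ pred0 B1 B2 B3 B4); split. Qed.
Let hD4 : homog_mx false D4.
Proof. by apply: (@homog_schur _ _ pred0 B4 B3 B2 B1); split. Qed.
Let uD1 : \det D1 \is a GRing.unit. Proof. exact: schur_unit. Qed.
Let uD4 : \det D4 \is a GRing.unit. Proof. exact: schur_unit. Qed.

Lemma Ber_mul_Ber_star :
  Ber (block_mx B1 B2 B3 B4) * Ber_star (block_mx B1 B2 B3 B4) = 1.
Proof.
have hP : homog_mx true (even_invmx B1 *m B2).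
  by apply: homog_cols_mul (homog_invmx h1 u1) h2.
have hQ : homog_mx true (even_invmx B4 *m B3).
  by apply: homog_cols_mul (homog_invmx h4 u4) h3.
have hPQ := homog_mx1D hP (homog_colsN hQ).
have hQP := homog_mx1D (homog_colsN hQ) hP.
have e1 := det_odd_pair two_neq0 hP (homog_colsN hQ).
(* The sign is moved to the other factor, so that both determinants belong to the same odd pair. *)
rewrite Ber_star_block !Ber_block !schurE // [_ *m - (_ *m B2)]mulmxN -mulNmx.
rewrite !(@det_mulmx_even _ _ _ pred0) //.
rewrite (even_central _ (homogV u4 (homog_det h4))) -mulrA.
rewrite [(\det B1)^-1 * _](even_central _ (homogV u1 (homog_det h1))).
by rewrite -!mulrA mulKr // (mulrA (\det (1%:M + _))) e1 mul1r mulrV.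
Qed.

Lemma homog_top_solution n (g : pred 'I_n) (v1 : 'M[A]_(r, n))
    (v3 : 'M[A]_(s, n)) : homog_cols g v1 -> homog_cols (predC g) v3 ->
  homog_cols g (top_solution B1 B2 B3 B4 v1 v3).
Proof.
move=> hv1 hv3; apply: homog_cols_mul (homog_invmx hD1 uD1) _ => //.
apply: homog_colsB => //.
apply: (homog_cols_mul (e := true) (f := predC g)) => // [j|].
  exact: negbK.
by apply: homog_cols_mul h2 (homog_invmx h4 u4).
Qed.

(* Both sides are the bottom part of the solution of [B *m w = v]. *)
Lemma bottom_solutionE n (v1 : 'M[A]_(r, n)) (v3 : 'M[A]_(s, n)) :
  top_solution B4 B3 B2 B1 v3 v1 =
  even_invmx B4 *m v3 - even_invmx B4 *m B3 *m top_solution B1 B2 B3 B4 v1 v3.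
Proof.
have : D1 *m top_solution B1 B2 B3 B4 v1 v3 = v1 - B2 *m even_invmx B4 *m v3.
  exact: mulKVmx_even.
move: (top_solution B1 B2 B3 B4 v1 v3) => w1 eD1.
rewrite -mulmxA -mulmxBr; set w3 := _ *m (_ - _).
(* The facts [e1] and [e4] are the two block rows of [B *m w = v]; eliminating [w1] gives the
   equation [D4] imposes on [w3]. *)
have e1 : B1 *m w1 = v1 - B2 *m w3.
  move/eqP: eD1; rewrite /D1 /schur mulmxBl subr_eq => /eqP ->.
  by rewrite /w3 !mulmxA mulmxBr opprB !mulmxA addrA addrAC.
have e4 : B4 *m w3 = v3 - B3 *m w1 by apply: mulKVmx_even.
rewrite /top_solution -/D4 -[RHS](mulKmx_even hD4 uD4); congr (_ *m _).
rewrite /D4 /schur mulmxBl e4 -[_ *m w3]mulmxA.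
have -> : B2 *m w3 = v1 - B1 *m w1 by rewrite e1 opprB addrC subrK.
by rewrite mulmxBr opprB mulmxA mulmxKV_even // addrA subrK.
Qed.

Section Minors.
Variables (g : pred 'I_r).
Hypothesis g1 : at_most_one g.
Variables (N1 : 'M[A]_r) (N2 : 'M[A]_(r, s)) (N3 : 'M[A]_(s, r)) (N4 : 'M[A]_s).
Hypothesis hN : super_blocks g N1 N2 N3 N4.
Variables (x y : A).
Hypotheses (hx : homog false x) (hy : homog false y) (uy : y \is a GRing.unit).

Let M1 := x *: top_solution B1 B2 B3 B4 N1 N3.
Let M2 := x *: top_solution B1 B2 B3 B4 N2 N4.
Let M3 := y *: top_solution B4 B3 B2 B1 N3 N1.
Let M4 := y *: top_solution B4 B3 B2 B1 N4 N2.

(* The blocks [M1 M2 M3 M4] are those of [diag (x, y) *m B^-1 *m N], where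
   [B^-1] factors into a lower unitriangular, a block diagonal and an upper
   unitriangular matrix. *)
Lemma super_blocks_solution : super_blocks g M1 M2 M3 M4 /\
  Ber (block_mx M1 M2 M3 M4) =
  x ^+ r * (y ^+ s)^-1 *
    ((Ber (block_mx B1 B2 B3 B4))^-1 * Ber (block_mx N1 N2 N3 N4)).
Proof.
have hU : homog_mx true (- (B2 *m even_invmx B4)).
  by apply: homog_colsN; apply: homog_cols_mul h2 (homog_invmx h4 u4).
have hV : homog_mx true (- (even_invmx B4 *m B3)).
  by apply: homog_colsN; apply: homog_cols_mul (homog_invmx h4 u4) h3.
have [sU eU] := super_blocks_upper hN hU.
have uI4 : \det (even_invmx B4) \is a GRing.unit.
  by rewrite det_invmx_even // unitrV.
have [sD eD] := super_blocks_diag g1 sU (homog_invmx hD1 uD1)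
  (homog_invmx h4 u4) uI4.
have [sV eV] := super_blocks_lower g1 sD hV.
have uys : \det (y%:M : 'M[A]_s) \is a GRing.unit.
  by rewrite det_scalar_even // unitrX.
have [] := super_blocks_diag g1 sV (homog_scalar_mx hx)
  (homog_scalar_mx hy) uys.
rewrite !mul_scalar_mx eV eD eU !det_scalar_even // !det_invmx_even // !mulNmx.
(* The lower factor leaves the bottom rows in the form on the right of [bottom_solutionE]. *)
rewrite /M3 /M4 !bottom_solutionE => sM ->; split=> //.
(* The diagonal factor with blocks [D1^-1] and [B4^-1] contributes exactly the inverse of the
   Berezinian of [B]. *)
by rewrite (Ber_block B1) -/D1 invrM ?unitrV // invrK.
Qed.

End Minors.
End Solution.
End Berezinians.

(** * Super minors and super Cramer's rule *)

Lemma pos_parity_lshift m n (u : 'I_m) : pos_parity (lshift n u) = false.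
Proof. by rewrite /pos_parity /= leqNgt ltn_ord. Qed.

Lemma pos_parity_rshift m n (u : 'I_n) : pos_parity (rshift m u) = true.
Proof. by rewrite /pos_parity /= leq_addr. Qed.

Section SuperMinorRelations.
Variables (k : fieldType) (L : comSuperUnitAlgType k).
Hypothesis two_neq0 : (2%:R : k) != 0.
Variables (r s p q : nat) (A : 'M[L]_(r + s, p + q)).
Hypothesis hA : even_supermatrix A.
Local Notation homog_mx e := (homog_cols (fun=> e)).
Local Notation col_parity := (@pos_parity p q).
Local Notation U I := (colsub I (usubmx A)).
Local Notation D I := (colsub I (dsubmx A)).

Lemma select_cols_block (I : 'I_r -> 'I_(p + q)) (J : 'I_s -> 'I_(p + q)) :
  select_cols A I J = block_mx (U I) (U J) (D I) (D J).
Proof.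
rewrite -[LHS]submxK; congr block_mx; apply/matrixP => u v; rewrite !mxE.
- by rewrite (unsplitK (inl _ v)).
- by rewrite (unsplitK (inr _ v)).
- by rewrite (unsplitK (inl _ v)).
- by rewrite (unsplitK (inr _ v)).
Qed.

Lemma sminor_block (I : 'I_r -> 'I_(p + q)) (J : 'I_s -> 'I_(p + q)) :
  sminor A I J = Ber (block_mx (U I) (U J) (D I) (D J)).
Proof. by rewrite /sminor select_cols_block. Qed.

Lemma sminor_star_block (I : 'I_r -> 'I_(p + q)) (J : 'I_s -> 'I_(p + q)) :
  sminor_star A I J = Ber (block_mx (D J) (D I) (U J) (U I)).
Proof. by rewrite /sminor_star select_cols_block Ber_star_block. Qed.

Lemma homog_usubmx n (J : 'I_n -> 'I_(p + q)) :
  homog_cols (fun j => col_parity (J j)) (U J).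
Proof.
move=> u v; have := hA (lshift s u) (J v).
by rewrite !mxE pos_parity_lshift.
Qed.

Lemma homog_dsubmx n (J : 'I_n -> 'I_(p + q)) :
  homog_cols (fun j => ~~ col_parity (J j)) (D J).
Proof.
move=> u v; have := hA (rshift r u) (J v).
by rewrite !mxE pos_parity_rshift.
Qed.

Lemma colsub_replace n m (I : 'I_n -> 'I_(p + q)) a c (M : 'M[L]_(m, p + q)) :
  colsub (replace I a c) M = set_col a (col c M) (colsub I M).
Proof. by apply/matrixP => u v; rewrite !mxE /replace; case: eqP. Qed.

(** Replacing an even column affects a single column of the Schur complement, so the ordinary Cramer
    rule applies to it. *)
Lemma schur_set_col m n (B1 : 'M[L]_m) B2 B3 (B4 : 'M[L]_n) a v1 v3 :
  schur (set_col a v1 B1) B2 (set_col a v3 B3) B4 =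
  set_col a (v1 - B2 *m even_invmx B4 *m v3) (schur B1 B2 B3 B4).
Proof.
rewrite /schur mulmx_set_col; apply/matrixP => u v; rewrite !mxE.
by case: ifP => _; rewrite ?mxE.
Qed.

(** Systems are solved column by column, so solving once for all columns of [A] serves every choice
    of columns. *)
Lemma top_solution_colsub m n (B1 : 'M[L]_m) B2 B3 (B4 : 'M[L]_n) t u
    (J : 'I_t -> 'I_u) v1 v3 :
  top_solution B1 B2 B3 B4 (colsub J v1) (colsub J v3) =
  colsub J (top_solution B1 B2 B3 B4 v1 v3).
Proof.
rewrite /top_solution -mulmx_colsub; congr (_ *m _).
by rewrite mulmx_colsub; apply/matrixP => x y; rewrite !mxE.
Qed.

Lemma top_solution_col m n (B1 : 'M[L]_m) B2 B3 (B4 : 'M[L]_n) u c v1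
    (v3 : 'M_(n, u)) a :
  top_solution B1 B2 B3 B4 (col c v1) (col c v3) a 0 =
  top_solution B1 B2 B3 B4 v1 v3 a c.
Proof.
have colE t (M : 'M[L]_(t, u)) : col c M = colsub (fun _ : 'I_1 => c) M.
  by apply/matrixP => x y; rewrite !mxE.
by rewrite !colE top_solution_colsub mxE.
Qed.

Variables (i : 'I_r -> 'I_p) (mu : 'I_s -> 'I_q).
Let ei := even_cols q i.
Let omu := odd_cols p mu.
Hypotheses (u1 : \det (U ei) \is a GRing.unit).
Hypotheses (u4 : \det (D omu) \is a GRing.unit).

Lemma homog_base : [/\ homog_mx false (U ei), homog_mx true (U omu),
  homog_mx true (D ei) & homog_mx false (D omu)].
Proof.
split=> u v.
- by have := homog_usubmx ei u v; rewrite /= pos_parity_lshift.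
- by have := homog_usubmx omu u v; rewrite /= pos_parity_rshift.
- by have := homog_dsubmx ei u v; rewrite /= pos_parity_lshift.
- by have := homog_dsubmx omu u v; rewrite /= pos_parity_rshift.
Qed.

Let X := sminor A ei omu.
Let Xs := sminor_star A ei omu.

(** [W1] and [W3] are the top and bottom parts of [B^-1 *m A], the bottom one written as a top
    solution with the parities exchanged. *)
Let W1 : 'M[L]_(r, p + q) :=
  top_solution (U ei) (U omu) (D ei) (D omu) (usubmx A) (dsubmx A).
Let W3 : 'M[L]_(s, p + q) :=
  top_solution (D omu) (D ei) (U omu) (U ei) (dsubmx A) (usubmx A).

(** Super Cramer's rule: the lower right block is untouched and the Schur complement changes in
    column [a] only. The index [c] may be even or odd. *)
Lemma sminor_replace a c : sminor A (replace ei a c) omu = X * W1 a c.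
Proof.
have [h1 h2 h3 h4] := homog_base.
rewrite /X !sminor_block !Ber_block !colsub_replace schur_set_col.
rewrite cramer_even; first last.
- exact: schur_unit.
- by apply: (@homog_schur _ _ _ _ pred0); split.
by rewrite mulrA -[W1 a c]top_solution_col.
Qed.

Lemma sminor_star_replace a c :
  sminor_star A ei (replace omu a c) = Xs * W3 a c.
Proof.
have [h1 h2 h3 h4] := homog_base.
rewrite /Xs !sminor_star_block !Ber_block !colsub_replace schur_set_col.
rewrite cramer_even; first last.
- exact: schur_unit.
- by apply: (@homog_schur _ _ _ _ pred0); split.
by rewrite mulrA -[W3 a c]top_solution_col.
Qed.

Lemma minors_mxE (J : 'I_r -> 'I_(p + q)) (N : 'I_s -> 'I_(p + q)) :
  minors_mx A i mu J N =
  block_mx (X *: top_solution (U ei) (U omu) (D ei) (D omu) (U J) (D J))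
           (X *: top_solution (U ei) (U omu) (D ei) (D omu) (U N) (D N))
           (Xs *: top_solution (D omu) (D ei) (U omu) (U ei) (D J) (U J))
           (Xs *: top_solution (D omu) (D ei) (U omu) (U ei) (D N) (U N)).
Proof.
rewrite /minors_mx; congr block_mx; apply/matrixP => u v;
by rewrite mxE ?sminor_replace ?sminor_star_replace top_solution_colsub !mxE.
Qed.

Lemma homog_X : homog false X.
Proof.
have [h1 h2 h3 h4] := homog_base; rewrite /X sminor_block.
exact: homog_Ber.
Qed.

Lemma homog_Xs : homog false Xs.
Proof.
have [h1 h2 h3 h4] := homog_base; rewrite /Xs sminor_star_block.
exact: homog_Ber.
Qed.

Lemma sminor_mul_star : X * Xs = 1.
Proof.
have [h1 h2 h3 h4] := homog_base.
rewrite /X /Xs sminor_block sminor_star_block -(Ber_star_block (U ei)).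
exact: Ber_mul_Ber_star.
Qed.

Lemma sminor_star_mul : Xs * X = 1.
Proof. by rewrite (even_central _ homog_Xs) sminor_mul_star. Qed.

Lemma sminor_unit : X \is a GRing.unit.
Proof.
by apply/unitrP; exists Xs; rewrite sminor_mul_star sminor_star_mul.
Qed.

Lemma sminor_starE : Xs = X^-1.
Proof. by rewrite -[LHS](mulKr sminor_unit) sminor_mul_star mulr1. Qed.

Lemma sminor_star_unit : Xs \is a GRing.unit.
Proof. by rewrite sminor_starE unitrV sminor_unit. Qed.

(** Scaling rows by the even elements [X] and [Xs] preserves the parities of [B^-1 *m A]. This
    places the right-hand sides in the domain of [Ber] or [Ber_star]. *)
Lemma homog_minors_mx (J : 'I_r -> 'I_(p + q)) (N : 'I_s -> 'I_(p + q)) u v :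
  homog (pos_parity u (+)
         col_parity (match split v with inl t => J t | inr b => N b end))
    (minors_mx A i mu J N u v).
Proof.
have [h1 h2 h3 h4] := homog_base.
have hU : homog_cols col_parity (usubmx A).
  by move=> x y; have := homog_usubmx id x y; rewrite mxE.
have hD : homog_cols (predC col_parity) (dsubmx A).
  by move=> x y; have := homog_dsubmx id x y; rewrite mxE.
have hW1 : homog_cols col_parity W1 by apply: homog_top_solution.
have hW3 : homog_cols (predC col_parity) W3.
  by apply: homog_top_solution => // x y; rewrite /= negbK.
have hu a c : homog (false (+) col_parity c) (sminor A (replace ei a c) omu).
  by rewrite sminor_replace; apply: homog_mul homog_X (hW1 _ _).
have hd a c :
    homog (true (+) col_parity c) (sminor_star A ei (replace omu a c)).
  by rewrite sminor_star_replace; apply: homog_mul homog_Xs (hW3 _ _).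
rewrite /minors_mx -[u]splitK -[v]splitK !unsplitK.
case: (split u) => a; case: (split v) => b /=;
rewrite ?(pos_parity_lshift, pos_parity_rshift) ?block_mxEul ?block_mxEur
  ?block_mxEdl ?block_mxEdr mxE.
all: by [apply: hu | apply: hd].
Qed.

(** Covers the even and the fake relation for [Ber], according to whether [J] contains no odd index
    or one. *)
Lemma minors_mx_Ber (J : 'I_r -> 'I_(p + q)) (N : 'I_s -> 'I_(p + q)) :
    (0 < r + s)%N -> at_most_one (fun t => col_parity (J t)) ->
    (forall b, col_parity (N b)) -> \det (D N) \is a GRing.unit ->
  \det (drsubmx (minors_mx A i mu J N)) \is a GRing.unit /\
  X ^+ (r + s - 1) * sminor A J N = Ber (minors_mx A i mu J N).
Proof.
move=> rs J1 hN uN; have [h1 h2 h3 h4] := homog_base.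
have hB : super_blocks (fun t => col_parity (J t)) (U J) (U N) (D J) (D N).
  split=> //; first exact: homog_usubmx.
  - by move=> x y; have := homog_usubmx N x y; rewrite hN.
  - exact: homog_dsubmx.
  - by move=> x y; have := homog_dsubmx N x y; rewrite hN.
have [] := super_blocks_solution two_neq0 h1 h2 h3 h4 u1 u4 J1 hB
  homog_X homog_Xs sminor_star_unit.
rewrite -minors_mxE -!sminor_block -/X => - [_ _ _ _ uM] eM.
split; first by rewrite minors_mxE block_mxKdr.
(* The row factors give [X ^+ r] and, as [Xs = X^-1], also [X ^+ s]; the factor [X^-1] from the base
   lowers the exponent by one. *)
rewrite eM sminor_starE exprVn invrK -exprD.
(* Positivity of [r + s] makes the truncated subtraction exact. *)
have -> : X ^+ (r + s) = X ^+ (r + s - 1) * X by rewrite -exprSr subn1 prednK.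
by rewrite -mulrA mulVKr // sminor_unit.
Qed.

(** The argument for [Ber] after exchanging parities: the blocks are swapped, and so are the roles
    of [X] and [Xs]. *)
Lemma minors_mx_Ber_star (J : 'I_r -> 'I_(p + q)) (N : 'I_s -> 'I_(p + q)) :
    (0 < r + s)%N -> at_most_one (fun t => ~~ col_parity (N t)) ->
    (forall b, ~~ col_parity (J b)) -> \det (U J) \is a GRing.unit ->
  \det (ulsubmx (minors_mx A i mu J N)) \is a GRing.unit /\
  Xs ^+ (r + s - 1) * sminor_star A J N = Ber_star (minors_mx A i mu J N).
Proof.
move=> rs N1 hJ uJ; have [h1 h2 h3 h4] := homog_base.
have hB : super_blocks (fun t => ~~ col_parity (N t)) (D N) (D J) (U N) (U J).
  split=> //; first exact: homog_dsubmx.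
  - by move=> x y; have := homog_dsubmx J x y; rewrite hJ.
  - by move=> x y; rewrite /= negbK; apply: homog_usubmx.
  - by move=> x y; have := homog_usubmx J x y; rewrite (negPf (hJ y)).
have [] := super_blocks_solution two_neq0 h4 h3 h2 h1 u4 u1 N1 hB
  homog_Xs homog_X sminor_unit.
rewrite -[Ber (block_mx (Xs *: _) _ _ _)]Ber_star_block -minors_mxE
  -!sminor_star_block -/Xs => - [_ _ _ _ uM] eM.
split; first by rewrite minors_mxE block_mxKul.
rewrite eM.
have -> : X = Xs^-1 by rewrite sminor_starE invrK.
rewrite exprVn invrK -exprD [(s + r)%N]addnC.
have -> : Xs ^+ (r + s) = Xs ^+ (r + s - 1) * Xs.
  by rewrite -exprSr subn1 prednK.
by rewrite -mulrA mulVKr // sminor_star_unit.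
Qed.

End SuperMinorRelations.

(** * The relations in the localization *)

Lemma replace_last_parity p q n (I : 'I_n -> 'I_(p + q)) c e :
    (forall a, pos_parity (I a) = e) -> pos_parity c = ~~ e ->
  forall a, @pos_parity p q (replace_last I c a) = e (+) (a.+1 == n).
Proof.
by move=> hI hc a; rewrite /replace_last; case: eqP; rewrite ?hI ?hc addbC.
Qed.

Theorem theorem7p1 (R : realType) (c : ground_kind) (r s p q : nat)
    (hr : (0 < r)%N) (hs : (0 < s)%N) (hrp : (r <= p)%N) (hsq : (s <= q)%N)
    (O : comSuperAlgType (ground_field R c)) (x : 'M[O]_(r + s, p + q))
    (hO : free_on_supermatrix x)
    (Ot : comSuperUnitAlgType (ground_field R c)) (iota : {lrmorphism O -> Ot})
    (hOt : localization_at (maximal_minor x) iota)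
    (i j : 'I_r -> 'I_p) (mu nu : 'I_s -> 'I_q)
    (hi : increasing i) (hj : increasing j)
    (hmu : increasing mu) (hnu : increasing nu)
    (lam : 'I_q) (y : 'I_p) :
  let A := map_mx iota x in
  let X := sminor A in
  let Xs := sminor_star A in
  let ei := even_cols q i in
  let ej := even_cols q j in
  let omu := odd_cols p mu in
  let onu := odd_cols p nu in
  let ej_lam := replace_last ej (rshift p lam) in
  let onu_y := replace_last onu (lshift q y) in
  let M := minors_mx A i mu in
  [/\ X ei omu * Xs ei omu = 1,
      Ber_defined (M ej onu) /\
        X ei omu ^+ (r + s - 1) * X ej onu = Ber (M ej onu),
      Ber_defined (M ej_lam onu) /\
        X ei omu ^+ (r + s - 1) * X ej_lam onu = Ber (M ej_lam onu) &
      Ber_star_defined (M ej onu_y) /\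
        Xs ei omu ^+ (r + s - 1) * Xs ej onu_y = Ber_star (M ej onu_y)].
Proof.
move=> A X Xs ei ej omu onu ej_lam onu_y M.
have two_neq0 : (2%:R : ground_field R c) != 0.
  by case: (c); rewrite /= Num.Theory.pnatr_eq0.
have [xh _] := hO; have [iotaP inv_iota _] := hOt.
have hA : even_supermatrix A by move=> u v; rewrite mxE; apply/iotaP/xh.
have unit_iota d : maximal_minor x d -> iota d \is a GRing.unit.
  by move=> /inv_iota [b [ab ba]]; apply/unitrP; exists b.
(* The diagonal blocks selected by increasing lists are images of maximal minors, which the
   localization inverts. *)
have unitU (f : 'I_r -> 'I_p) : increasing f ->
    \det (colsub (even_cols q f) (usubmx A)) \is a GRing.unit.
  move=> hf; have := unit_iota _ (or_introl (ex_intro2 _ _ f hf erefl)).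
  rewrite -det_map_mx; congr (\det _ \is a _).
  by apply/matrixP => u v; rewrite !mxE.
have unitD (f : 'I_s -> 'I_q) : increasing f ->
    \det (colsub (odd_cols p f) (dsubmx A)) \is a GRing.unit.
  move=> hf; have := unit_iota _ (or_intror (ex_intro2 _ _ f hf erefl)).
  rewrite -det_map_mx; congr (\det _ \is a _).
  by apply/matrixP => u v; rewrite !mxE.
have rs : (0 < r + s)%N by rewrite addn_gt0 hr.
have hM := homog_minors_mx two_neq0 hA (unitU _ hi) (unitD _ hmu).
have pej a : pos_parity (ej a) = false by apply: pos_parity_lshift.
have ponu b : pos_parity (onu b) = true by apply: pos_parity_rshift.
have pej_lam := replace_last_parity pej (pos_parity_rshift p lam).
have ponu_y := replace_last_parity ponu (pos_parity_lshift q y).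
(* Translates the test of [replace_last] into equality with the last position, the witness for fake
   supermatrices. *)
have lastE n (a : 'I_n) : (a.+1 == n) = (a == n.-1 :> nat).
  by case: n a => [[]//|n a]; rewrite eqSS.
have last_inj n : at_most_one (fun a : 'I_n => a.+1 == n).
  by move=> a b /eqP an /eqP bn; apply/val_inj/succn_inj; rewrite an bn.
split.
- exact: (sminor_mul_star two_neq0 hA (unitU _ hi) (unitD _ hmu)).
- have [] := minors_mx_Ber two_neq0 hA (unitU _ hi) (unitD _ hmu) (J := ej) rs
    (* No index of [ej] is odd, so the condition holds vacuously. *)
    _ ponu (unitD _ hnu); first by move=> a b; rewrite pej.
  move=> uM eM; split=> //; split=> //; left=> u v; have := hM ej onu u v.
  rewrite -[v]splitK unsplitK; case: (split v) => a /=.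
    by rewrite pej pos_parity_lshift.
  by rewrite ponu pos_parity_rshift.
- have [] := minors_mx_Ber two_neq0 hA (unitU _ hi) (unitD _ hmu)
    (J := ej_lam) rs _ ponu (unitD _ hnu).
    by move=> a b; rewrite !pej_lam; apply: last_inj.
  move=> uM eM; split=> //; split=> //; right.
  (* The odd vector of this type I fake stands in the last even position, that of [lam]. *)
  have hl : (r.-1 < r)%N by rewrite prednK.
  exists (Ordinal hl) => u v; have := hM ej_lam onu u v.
  rewrite -[v]splitK unsplitK; case: (split v) => a /=.
    rewrite pej_lam pos_parity_lshift (inj_eq (@lshift_inj _ _)) -val_eqE /=.
    by rewrite lastE addbF.
  by rewrite ponu pos_parity_rshift eq_rlshift addbF.
- have [] := minors_mx_Ber_star two_neq0 hA (unitU _ hi) (unitD _ hmu)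
    (N := onu_y) rs _ (fun a => negbT (pej a)) (unitU _ hj).
    by move=> a b; rewrite !ponu_y !addTb !negbK; apply: last_inj.
  move=> uM eM; split=> //; split=> //; right.
  (* The even vector of this type II fake stands in the last odd position, that of [y]. *)
  have hl : (s.-1 < s)%N by rewrite prednK.
  exists (Ordinal hl) => u v; have := hM ej onu_y u v.
  rewrite -[v]splitK unsplitK; case: (split v) => a /=.
    by rewrite pej pos_parity_lshift eq_lrshift !addbF.
  rewrite ponu_y pos_parity_rshift (inj_eq (@rshift_inj _ _)) -val_eqE /=.
  by rewrite lastE addbT addbN addNb.
Qed.
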